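(* Let $n\ge 2$ be an integer, let $k\ge t\ge 2$ be integers, and let $s_1,\dots,s_k$ and $M$ be positive integers. If there exists an $\mathrm{OA}(M,s_1s_2\cdots s_k,t)$, then there exists an optimal $$\mathrm{NOA}\bigl((nM,M),\,k,\,((ns_1)s_2\cdots s_k,\ s_1s_2\cdots s_k),\,t\bigr).$$
   Context: For a positive integer $s$, $\mathbb{Z}_s=\{0,1,\dots,s-1\}$. Arrays are nonempty finite multisets of rows; $|A|$ counts rows with multiplicity. Let $G=\mathbb{Z}_{s_1}\times\cdots\times\mathbb{Z}_{s_k}$; for $I=\{i_1,\dots,i_t\}\subseteq\{1,\dots,k\}$ let $G_I=\mathbb{Z}_{s_{i_1}}\times\cdots\times\mathbb{Z}_{s_{i_t}}$ and let $\pi_I:G\to G_I$ be the coordinate projection. For $1\le t\le k$, a finite multiset $A$ of elements of $G$ is an orthogonal array of strength $t$ over $G$, denoted $\mathrm{OA}(|A|,s_1s_2\cdots s_k,t)$, if for every $I$ with $|I|=t$ there is a positive integer $\lambda_I$ with $|\{\alpha\in A:\pi_I(\alpha)=\beta\}|=\lambda_I$ for all $\beta\in G_I$ (counted with multiplicity). In this notation $s_1s_2\cdots s_k$ is the list of numbers of levels of the $k$ factors, not a product; $(ns_1)s_2\cdots s_k$ means that the first factor has $ns_1$ levels and factor $i\ge2$ has $s_i$ levels. Nested orthogonal array: let $S_i\ge R_i$ be positive integers for $1\le i\le k$, with strict inequality for at least one $i$. An $\mathrm{NOA}((N,M),k,(S_1S_2\cdots S_k,R_1R_2\cdots R_k),t)$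 is an $\mathrm{OA}(N,S_1\cdots S_k,t)$, $A$, over $\mathbb{Z}_{S_1}\times\cdots\times\mathbb{Z}_{S_k}$ that contains a subarray (sub-multiset of rows) $B$ whose rows lie in $\prod_i\{0,\dots,R_i-1\}$ and which is an $\mathrm{OA}(M,R_1\cdots R_k,t)$ over $\mathbb{Z}_{R_1}\times\cdots\times\mathbb{Z}_{R_k}$. Optimality: with the factors indexed so that $\frac{S_1}{R_1}=\max_i\frac{S_i}{R_i}$ (which holds for the array in the claim), such an NOA is called optimal if $N$ equals $$M\sum_{i=0}^{t/2}\sum_{\substack{I\subseteq\{1,\dots,k\}\\|I|=i}}\prod_{j\in I}\Bigl(\frac{S_j}{R_j}-1\Bigr)\quad\text{when } t \text{ is even},$$ $$M\left[\sum_{i=0}^{\lfloor t/2\rfloor}\sum_{\substack{I\subseteq\{1,\dots,k\}\\|I|=i}}\prod_{j\in I}\Bigl(\frac{S_j}{R_j}-1\Bigr)+\Bigl(\frac{S_1}{R_1}-1\Bigr)\sum_{\substack{I\subseteq\{2,\dots,k\}\\|I|=\lfloor t/2\rfloor}}\prod_{j\in I}\Bigl(\frac{S_j}{R_j}-1\Bigr)\right]\quad\text{when } t\text{ is odd}.$$ Empty products equal $1$. *)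

(* Defs.v *)
From mathcomp Require Import all_boot all_order all_algebra finmap multiset.

Set Implicit Arguments.
Unset Strict Implicit.
Unset Printing Implicit Defensive.

Import Order.TTheory GRing.Theory Num.Theory.

Local Open Scope ring_scope.
Local Open Scope mset_scope.

(* The k factors are indexed by 'I_k, so that the first factor has index 0.
   Rows are nat-valued, since a row of a nested array must be readable both over
   the large level set prod_i {0, ..., S i - 1} and over the small one. *)
Definition oa_row (k : nat) := {ffun 'I_k -> nat}.

Definition in_levels (T : finType) (s : T -> nat) (a : {ffun T -> nat}) : Prop :=
  forall i, (a i < s i)%N.

Definition proj (k : nat) (I : {set 'I_k}) (a : oa_row k) :
    {ffun {i : 'I_k | i \in I} -> nat} :=
  [ffun i => a (val i)].

Definition is_OA (k N : nat) (s : 'I_k -> nat) (t : nat) (A : {mset oa_row k}) : Prop :=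
  [/\ (0 < t <= k)%N,
      forall i, (0 < s i)%N,
      (0 < N)%N /\ size A = N,
      forall a, a \in A -> in_levels s a
    & forall I : {set 'I_k}, #|I| = t ->
        exists2 lam : nat, (0 < lam)%N &
          forall b : {ffun {i : 'I_k | i \in I} -> nat},
            in_levels (fun i => s (val i)) b ->
            count (fun a => proj I a == b) A = lam].

Definition is_NOA (k N M : nat) (S R : 'I_k -> nat) (t : nat) (A : {mset oa_row k}) :
    Prop :=
  [/\ forall i, (0 < R i <= S i)%N,
      exists i, (R i < S i)%N,
      is_OA N S t A
    & exists2 B : {mset oa_row k}, B `<=` A & is_OA M R t B].

Definition level_ratio (k : nat) (S R : 'I_k -> nat) (i : 'I_k) : rat :=
  (S i)%:R / (R i)%:R.

Definition NOA_size_bound (k M : nat) (S R : 'I_k -> nat) (t : nat) (i1 : 'I_k) :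
    rat :=
  let main :=
    \sum_(i < t./2.+1) \sum_(I : {set 'I_k} | #|I| == i)
      \prod_(j in I) (level_ratio S R j - 1) in
  let extra :=
    (level_ratio S R i1 - 1) *
    \sum_(I : {set 'I_k} | (I \subset [set~ i1]) && (#|I| == t./2))
      \prod_(j in I) (level_ratio S R j - 1) in
  if odd t then M%:R * (main + extra) else M%:R * main.

(* The indexing convention that the first factor has the largest ratio S i / R i
   is part of the definition. *)
Definition is_optimal_NOA (k N M : nat) (S R : 'I_k -> nat) (t : nat)
    (A : {mset oa_row k}) : Prop :=
  is_NOA N M S R t A /\
  exists i1 : 'I_k,
    [/\ i1 = 0%N :> nat,
        forall i, level_ratio S R i <= level_ratio S R i1
      & N%:R = NOA_size_bound M S R t i1].

Definition scale_first (k n : nat) (s : 'I_k -> nat) (i : 'I_k) : nat :=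
  if (i : nat) == 0%N then (n * s i)%N else s i.

(* Main.v *)
(* Juxtapose n copies of the given array B, the j-th one having its first
   coordinate translated by j * s_1. Euclidean division by s_1 splits a level of
   the enlarged first factor into a copy index and an old level, so a projection
   seeing the first factor meets each tuple in exactly one copy, and any other
   projection meets it in all n copies. The copy j = 0 is B itself. In the size
   bound every ratio but the first equals 1, so only the empty set and {1}
   contribute, giving M (1 + (n - 1)) = n M. *)
Require Import Defs.
From mathcomp Require Import all_boot all_order all_algebra finmap multiset.

Set Implicit Arguments.
Unset Strict Implicit.
Unset Printing Implicit Defensive.

Import Order.TTheory GRing.Theory Num.Theory.

Local Open Scope mset_scope.

Definition shift_row (k : nat) (i0 : 'I_k) (c : nat) (a : oa_row k) : oa_row k :=
  [ffun i => if i == i0 then (c + a i)%N else a i].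

Definition shifted_copies (k n : nat) (i0 : 'I_k) (c : nat) (B : seq (oa_row k)) :
    seq (oa_row k) :=
  [seq shift_row i0 (j * c) a | j <- iota 0 n, a <- B].

Lemma shift_row0 (k : nat) (i0 : 'I_k) (a : oa_row k) : shift_row i0 0 a = a.
Proof. by apply/ffunP => i; rewrite ffunE add0n if_same. Qed.

Lemma count_shifted_copies (k n : nat) (i0 : 'I_k) (c : nat) (B : seq (oa_row k))
    (P : pred (oa_row k)) :
  count P (shifted_copies n i0 c B) =
  (\sum_(j < n) count (fun a => P (shift_row i0 (j * c) a)) B)%N.
Proof.
rewrite /shifted_copies count_flatten -map_comp sumnE big_map.
rewrite -[n in iota 0 n]subn0 -/(index_iota 0 n) big_mkord.
by apply: eq_bigr => j _ /=; rewrite count_map.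
Qed.

Lemma proj_shift_row_notin (k : nat) (I : {set 'I_k}) (i0 : 'I_k) (c : nat)
    (a : oa_row k) :
  i0 \notin I -> proj I (shift_row i0 c a) = proj I a.
Proof.
move=> i0I; apply/ffunP => -[i iI]; rewrite !ffunE /=.
by case: eqP => // ii0; rewrite -ii0 iI in i0I.
Qed.

(** Since [a i0 < c], the numbers [j] and [a i0] are the quotient and remainder of the shifted entry
    by [c]. The condition thus separates into one on the copy and one on the original row, which
    lets the rows be counted copy by copy. *)
Lemma proj_shift_row_eq (k : nat) (I : {set 'I_k}) (i0 : 'I_k) (i0I : i0 \in I)
    (c j : nat) (a : oa_row k) (b : {ffun {i : 'I_k | i \in I} -> nat}) :
  (a i0 < c)%N ->
  (proj I (shift_row i0 (j * c) a) == b) =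
  (j == b (exist _ i0 i0I) %/ c)%N &&
  (proj I a == [ffun i => if val i == i0 then (b i %% c)%N else b i]).
Proof.
move=> ac; have c0 : (0 < c)%N by apply: leq_ltn_trans ac.
apply/eqP/andP => [<-|[/eqP jE /eqP aE]].
  rewrite !ffunE /= eqxx divnMDl // divn_small // addn0 eqxx; split=> //.
  apply/eqP/ffunP => i; rewrite !ffunE.
  by case: eqP => //= ->; rewrite modnMDl modn_small.
apply/ffunP => i; have := congr1 (fun f : {ffun _ -> nat} => f i) aE.
rewrite !ffunE; case: eqP => //= ii0 ->.
(* The entry of [b] at [i0] is rebuilt from its quotient and remainder. *)
rewrite jE (_ : exist _ i0 i0I = i) -?divn_eq //; exact/val_inj.
Qed.

Lemma is_OA_shifted_copies (k n M t : nat) (s S : 'I_k -> nat) (i0 : 'I_k)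
    (B : {mset oa_row k}) :
  (0 < n)%N -> (forall i, S i = if i == i0 then (n * s i)%N else s i) ->
  is_OA M s t B ->
  is_OA (n * M) S t (seq_mset (shifted_copies n i0 (s i0) B)).
Proof.
move=> n0 SE [tk s0 [M0 sizeB] Bs BOA]; split=> //.
- by move=> i; rewrite SE; case: ifP; rewrite ?muln_gt0 ?n0 s0.
- split; first by rewrite muln_gt0 n0.
  by rewrite (perm_size (perm_eq_seq_mset _)) size_allpairs size_iota sizeB.
- move=> a; rewrite (perm_mem (perm_eq_seq_mset _)).
  case/allpairsP => -[j b] /= [+ bB ->]; rewrite mem_iota add0n /= => jn i.
  have := Bs _ bB i; rewrite ffunE SE; case: eqP => // -> bi.
  (* The shifted entry is below [j.+1 * s i0], and [j < n]. *)
  by rewrite (@leq_trans (j.+1 * s i0)) ?leq_mul2r ?jn ?orbT// mulSn addnC ltn_add2r.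
move=> I It; have [lam lam0 lamE] := BOA I It.
have [i0I|i0I] := boolP (i0 \in I); last first.
  (* The shift is invisible on [I], so each of the [n] copies contributes [lam]. *)
  exists (n * lam)%N => [|b bS]; first by rewrite muln_gt0 n0.
  rewrite (permP (perm_eq_seq_mset _)) count_shifted_copies.
  under eq_bigr => j _ do under eq_count => a do rewrite proj_shift_row_notin //.
  rewrite sum_nat_const card_ord lamE // => -[i iI].
  have := bS (exist _ i iI); rewrite SE /=.
  by case: eqP => // ii0; rewrite -ii0 iI in i0I.
(* Only copy [q] can meet [b]; it does so [lam] times, as [b] with its [i0] entry reduced modulo
   [s i0] is a tuple over the old levels. *)
exists lam => // b bS; pose q := (b (exist _ i0 i0I) %/ s i0)%N.
have qn : (q < n)%N.
  by have := bS (exist _ i0 i0I); rewrite SE eqxx ltn_divLR.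
rewrite (permP (perm_eq_seq_mset _)) count_shifted_copies.
rewrite (bigD1 (Ordinal qn)) //= [X in (_ + X)%N]big1 => [|j jq].
  rewrite addn0; under eq_in_count => a aB do
    rewrite (proj_shift_row_eq i0I) ?(Bs _ aB) // eqxx.
  apply: lamE => i; rewrite ffunE.
  by have := bS i; rewrite SE; case: eqP => // ->; rewrite ltn_mod s0.
under eq_in_count => a aB do
  rewrite (proj_shift_row_eq i0I) ?(Bs _ aB) // -[X in j == X :> nat]/(val (Ordinal qn))
    val_eqE (negPf jq).
by rewrite count_pred0.
Qed.

Lemma msub_shifted_copies (k n : nat) (i0 : 'I_k) (c : nat) (B : {mset oa_row k}) :
  (0 < n)%N -> B `<=` seq_mset (shifted_copies n i0 c B).
Proof.
case: n => // n _; apply/msubsetP => a.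
rewrite -!count_mem_mset (permP (perm_eq_seq_mset _)) count_shifted_copies.
rewrite big_ord_recl mul0n.
(* The term of index 0 is the multiplicity of [a] in [B]. *)
rewrite [X in (_ <= X + _)%N](eq_count (a2 := pred1 a)) ?leq_addr // => x.
by rewrite /= shift_row0.
Qed.

Local Open Scope ring_scope.

(** A product vanishes as soon as its index set leaves [[set i1]], so the two surviving terms add up
    to [1 + (r i1 - 1)]. *)
Lemma NOA_size_bound_one_ratio (k M : nat) (S R : 'I_k -> nat) (t : nat) (i1 : 'I_k) :
  (2 <= t)%N -> (forall i, i != i1 -> level_ratio S R i = 1) ->
  NOA_size_bound M S R t i1 = M%:R * level_ratio S R i1.
Proof.
move=> t2 ratio1; set r := level_ratio S R.
have prod0 (I : {set 'I_k}) : ~~ (I \subset [set i1]) -> \prod_(j in I) (r j - 1) = 0.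
  case/subsetPn => i iI; rewrite inE => /ratio1 ri.
  by rewrite (bigD1 i) //= /r ri subrr mul0r.
have sub1 (I : {set 'I_k}) : I \subset [set i1] -> (#|I| <= 1)%N.
  by move/subset_leq_card; rewrite cards1.
(* Positivity of [t./2] puts size 1 in the main sum and makes the sets of the extra sum nonempty;
   these avoid [i1], so for odd [t] the extra sum is zero. *)
have [h hE] : exists h, t./2 = h.+1 by case: t t2 => [|[|t]] // _; exists t./2.
rewrite /NOA_size_bound hE -/r.
have -> : \sum_(I : {set 'I_k} | (I \subset [set~ i1]) && (#|I| == h.+1))
    \prod_(j in I) (r j - 1) = 0.
  apply: big1 => I /andP[Ii1 /eqP cI]; apply: prod0.
  apply/negP => Is; have : I \subset [set i1] :&: [set~ i1] by rewrite subsetI Is.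
  by rewrite setICr subset0 => /eqP I0; rewrite I0 cards0 in cI.
rewrite mulr0 addr0 if_same; congr (_ * _).
(* Sizes 0 and 1 are split off; a larger set does not fit in [[set i1]]. *)
rewrite 2!big_ord_recl [X in _ + (_ + X)]big1 => [|i _]; last first.
  apply: big1 => I /eqP cI; apply: prod0.
  by apply/negP => /sub1; rewrite cI.
rewrite (big_pred1 set0) => [|I]; last by rewrite cards_eq0.
rewrite big_set0 (bigD1 [set i1]) ?cards1 //= big_set1 [X in _ + X + _]big1.
  by rewrite !addr0 addrC subrK.
move=> I /andP[cI In]; apply: prod0; apply: contra In.
by rewrite eqEcard (eqP cI) cards1 => ->.
Qed.

Theorem theorem4p10 (n k t M : nat) (s : 'I_k -> nat)
    (hn : (2 <= n)%N) (ht : (2 <= t)%N) (htk : (t <= k)%N)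
    (hs : forall i, (0 < s i)%N) (hM : (0 < M)%N) :
  (exists A : {mset oa_row k}, is_OA M s t A) ->
  exists A : {mset oa_row k}, is_optimal_NOA (n * M)%N M (scale_first n s) s t A.
Proof.
case=> B BOA; have n0 : (0 < n)%N by apply: ltnW.
have k0 : (0 < k)%N by apply: leq_trans htk; apply: ltnW.
pose i0 := Ordinal k0.
have SE i : scale_first n s i = if i == i0 then (n * s i)%N else s i by [].
have s_neq0 i : (s i)%:R != 0 :> rat by rewrite pnatr_eq0 -lt0n.
have ratio0 : level_ratio (scale_first n s) s i0 = n%:R.
  by rewrite /level_ratio SE eqxx natrM mulfK.
have ratio1 i : i != i0 -> level_ratio (scale_first n s) s i = 1.
  by move=> /negPf ii0; rewrite /level_ratio SE ii0 divff.
exists (seq_mset (shifted_copies n i0 (s i0) B)); split; first split.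
- by move=> i; rewrite hs SE /=; case: ifP => // _; rewrite leq_pmull.
- by exists i0; rewrite SE eqxx ltn_Pmull.
- exact: is_OA_shifted_copies.
- by exists B => //; apply: msub_shifted_copies.
exists i0; split=> // [i|].
  have [->//|/ratio1 ->] := eqVneq i i0.
  by rewrite ratio0 ler1n.
by rewrite NOA_size_bound_one_ratio // ratio0 natrM mulrC.
Qed.
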